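(* Let $\Lambda$ be a logic, let $\mathscr T$ be a local translation of the cyclic formula $\phi$ in $\Lambda$ and $\mathscr T'$ a local translation of the cyclic formula $\phi'$ in $\Lambda$, and let $R$ be a bisimulation between $\phi$ and $\phi'$ (not necessarily relating the roots). If $aRa'$, then $\Lambda\vdash\mathscr T(a)\leftrightarrow\mathscr T'(a')$.
   Context: Labels: $\bot,\top$ and propositional variables (arity 0), $\neg,\Box$ (arity 1), $\wedge,\vee,\to$ (arity 2). A graph is $\langle V,r,S,\lambda\rangle$ with $V$ finite, root $r$, labelling $\lambda$, $S:V\to V^{*}$ ordered successors (length = arity of label), $S_i(a)$ the $i$-th; every vertex reachable from $r$. A (cyclic) formula is a graph in which every cycle (closed path of pairwise distinct vertices along successors) contains a $\Box$-labelled vertex. A bisimulation between graphs is a relation $R$ such that $aRa'$ implies equal labels and $S_i(a)RS'_i(a')$ for all $i$; $\simeq$ = bisimilarity relating roots. $\langle\phi\rangle_a$ is the subgraph generated by $a$. A language $\mathcal L$ is a set of cyclic formulas closed under bisimilarity, containing the variables, closed under the connectives, under generated subgraphs, and under substitution. ${\sf HL}(\mathcal L)$ is the least set of $\mathcal L$-formulas containing all substitution instances of propositional tautologies, all $\Box(\phi\to\psi)\to(\Box\phi\to\Box\psi)$, all $\phi\leftrightarrow\psi$ with $\phi\simeq\psi$, closed under modus ponens, necessitation, and Löb's rule (from $\vdash\Box\phi\to\phi$ infer $\vdash\phi$). A logic $\Lambda$ is an extension of some ${\sf HL}(\mathcal L)$ in the same language by schematic axioms/rules, still closed under the rules of ${\sf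 HL}(\mathcal L)$. A local translation of $\phi$ into $\Lambda$ is a map $\mathscr T$ from the vertices of $\phi$ to formulas of the language of $\Lambda$ such that for every vertex $a$ with label $\$$ of arity $n$ (variables being $0$-ary), $\Lambda\vdash\mathscr T(a)\leftrightarrow\$(\mathscr T(S_0a),\dots,\mathscr T(S_{n-1}a))$. *)

(* Defs.v *)
From HB Require Import structures.
From mathcomp Require Import all_boot.
Set Implicit Arguments.
Unset Strict Implicit.
Unset Printing Implicit Defensive.

(* The propositional variables are indexed by nat. *)
Inductive label : Type :=
  | Bot | Top | Var of nat | Neg | Box | And | Or | Imp.

Definition arity (l : label) : nat :=
  match l with
  | Bot | Top | Var _ => 0
  | Neg | Box => 1
  | And | Or | Imp => 2
  end.

Definition is_box (l : label) : bool := if l is Box then true else false.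
Definition is_var (l : label) : bool := if l is Var _ then true else false.

Record graph := Graph {
  vertex :> finType;
  root : vertex;
  lab : vertex -> label;
  succ : vertex -> seq vertex;
  size_succ : forall a, size (succ a) = arity (lab a);
  reachable : forall a, connect (grel succ) root a
}.
Arguments lab {g} a.
Arguments succ {g} a.
Arguments reachable {g} a.

(* [child a i] is S_i(a); the default value [a] is irrelevant for
   i < arity (lab a). *)
Definition child (g : graph) (a : g) (i : nat) : g := nth a (succ a) i.

(* MathComp's [ucycle] accepts the empty sequence, hence the side condition. *)
Definition guarded (g : graph) : Prop :=
  forall c : seq g, c != [::] -> ucycle (grel succ) c ->
    exists2 a, a \in c & lab a = Box.

Record cformula := CFormula {
  cgraph :> graph;
  cguarded : guarded cgraph
}.

Definition bisimulation (g g' : graph) (R : g -> g' -> Prop) : Prop :=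
  forall a a', R a a' ->
    lab a = lab a' /\
    forall i, i < arity (lab a) -> R (child a i) (child a' i).

Definition bisimilar (g g' : graph) : Prop :=
  exists2 R : g -> g' -> Prop, bisimulation R & R (root g) (root g').

(* A graph is guarded iff some natural-valued rank strictly decreases along
   the edges that leave non-box vertices. *)
Section Rank.
Variable g : graph.

Definition nonbox_edge : rel g :=
  [rel a b | ~~ is_box (lab a) && (b \in succ a)].

Definition rank (a : g) : nat := #|[pred b | connect nonbox_edge a b]|.

Lemma rank_succ (a b : g) : guarded g ->
  ~~ is_box (lab a) -> b \in succ a -> rank b < rank a.
Proof.
move=> gg na ab; apply: proper_card; apply/properP; split.
  apply/subsetP => c; rewrite !inE => bc.
  by apply: connect_trans bc; apply: connect1; apply/andP.
exists a; rewrite !inE ?connect0 //.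
apply/negP => /connectP [p0 p0P la0].
case: (shortenP p0P) la0 => p pP up _ la.
have [||c cp cB] := gg (b :: p) => //.
  apply/andP; split=> //; rewrite /cycle rcons_path -la /= ab andbT.
  by apply: sub_path pP => x y /andP [].
have: all (fun x => ~~ is_box (lab x)) (b :: p).
  rewrite lastI all_rcons -la na /=.
  elim: p b pP {ab la up cp p0P} => //= y p IH x /andP [/andP [-> _] /IH].
  by [].
by move/allP/(_ _ cp); rewrite cB.
Qed.

Lemma rank_le (a : g) : rank a <= #|g|.
Proof. exact: max_card. Qed.

Lemma rank_guarded (f : g -> nat) :
  (forall a b : g, ~~ is_box (lab a) -> b \in succ a -> f b < f a) ->
  guarded g.
Proof.
move=> fP [|x c] // _ /andP [cyc _].
case: (boolP (has (fun a => is_box (lab a)) (x :: c))).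
  by case/hasP => a ac aB; exists a => //; case: (lab a) aB.
rewrite -all_predC => nB; exfalso.
have: path (fun a b => f b < f a) x (rcons c x).
  move: cyc; rewrite /cycle.
  apply: (sub_in_path (P := fun a => ~~ is_box (lab a))).
    by move=> a b na _; apply: fP.
  by move: nB; rewrite /= all_rcons => /andP [-> ->].
have tr : transitive (fun a b => f b < f a).
  by move=> b a d /= h1 h2; apply: ltn_trans h2 h1.
by move/(order_path_min tr); rewrite all_rcons ltnn.
Qed.

End Rank.

(* l(args_0, ..., args_{n-1}): a new root [None] labelled l, on top of the
   disjoint union of the arguments. *)
Section Connective.
Variables (l : label) (args : 'I_(arity l) -> cformula).

Definition conn_vertex : finType := option {i : 'I_(arity l) & args i}.

Definition conn_in (i : 'I_(arity l)) (b : args i) : conn_vertex :=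
  Some (Tagged (fun i => args i : Type) b).

Definition conn_lab (a : conn_vertex) : label :=
  if a is Some u then lab (tagged u) else l.

Definition conn_succ (a : conn_vertex) : seq conn_vertex :=
  if a is Some u then [seq conn_in b | b <- succ (tagged u)]
  else [seq conn_in (root (args i)) | i <- enum 'I_(arity l)].

Lemma conn_size a : size (conn_succ a) = arity (conn_lab a).
Proof.
by case: a => [u|] /=; rewrite size_map ?size_succ // -cardE card_ord.
Qed.

Lemma conn_reach a : connect (grel conn_succ) None a.
Proof.
case: a => [[i b]|]; last exact: connect0.
apply: (@connect_trans _ _ (conn_in (root (args i)))).
  by apply: connect1 => /=; apply: map_f; rewrite mem_enum.
have /connectP [p pP ->] := reachable b.
apply/connectP; exists (map (@conn_in i) p); last first.
  by rewrite last_map.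
elim: p (root _) pP => //= y p IH x /andP [xy /IH ->].
by rewrite andbT; apply: map_f.
Qed.

Definition conn_graph := Graph conn_size conn_reach.

Lemma conn_guarded : guarded conn_graph.
Proof.
pose f (a : conn_graph) :=
  if a is Some u then rank (tagged u)
  else (\max_(i < arity l) rank (root (args i))).+1.
apply: (@rank_guarded _ f) => -[[i a]|] b /= na /mapP [].
  by move=> c ca -> /=; apply: rank_succ => //; apply: cguarded.
move=> i _ -> /=; rewrite ltnS.
exact: (@leq_bigmax _ (fun i => rank (root (args i)))).
Qed.

Definition cconn : cformula := CFormula conn_guarded.
End Connective.

Definition no_arg (i : 'I_0) : cformula :=
  match notF (ltn_ord i) with end.
Definition one_arg (A : cformula) (i : 'I_1) : cformula := A.
Definition two_args (A B : cformula) (i : 'I_2) : cformula :=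
  if val i == 0 then A else B.

Definition cVar (p : nat) : cformula := @cconn (Var p) no_arg.
Definition cBot : cformula := @cconn Bot no_arg.
Definition cTop : cformula := @cconn Top no_arg.
Definition cNeg (A : cformula) : cformula := @cconn Neg (one_arg A).
Definition cBox (A : cformula) : cformula := @cconn Box (one_arg A).
Definition cAnd (A B : cformula) : cformula := @cconn And (two_args A B).
Definition cOr (A B : cformula) : cformula := @cconn Or (two_args A B).
Definition cImp (A B : cformula) : cformula := @cconn Imp (two_args A B).
Definition cIff (A B : cformula) : cformula := cAnd (cImp A B) (cImp B A).

(* The subgraph generated by a. *)
Section Generated.
Variables (phi : cformula) (a : phi).

Definition gen_vertex : finType := {b : phi | connect (grel succ) a b}.

Definition gen_root : gen_vertex := Sub a (connect0 _ a).

Definition gen_lab (b : gen_vertex) : label := lab (val b).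

Definition gen_succ (b : gen_vertex) : seq gen_vertex :=
  pmap insub (succ (val b)).

Lemma gen_succ_conn (b : gen_vertex) c :
  c \in succ (val b) -> connect (grel succ) a c.
Proof.
by move=> bc; apply: connect_trans (valP b) _; apply: connect1.
Qed.

Lemma gen_size b : size (gen_succ b) = arity (gen_lab b).
Proof.
rewrite size_pmap_sub -size_succ; apply/eqP; rewrite -all_count.
by apply/allP => c; apply: gen_succ_conn.
Qed.

Lemma gen_reach b : connect (grel gen_succ) gen_root b.
Proof.
have /connectP [p pP lb] := valP b.
have H (x : gen_vertex) q : path (grel succ) (val x) q ->
    val b = last (val x) q -> connect (grel gen_succ) x b.
  elim: q x => [|y q IH] x /=; first by move=> _ /val_inj ->; apply: connect0.
  case/andP => xy; pose z : gen_vertex := Sub y (gen_succ_conn xy).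
  move=> yq lq; apply: (@connect_trans _ _ z); last exact: IH.
  by apply: connect1; rewrite /= mem_pmap_sub.
exact: (H gen_root p).
Qed.

Definition gen_graph := Graph gen_size gen_reach.

Lemma gen_guarded : guarded gen_graph.
Proof.
apply: (@rank_guarded _ (fun b : gen_graph => rank (val b))) => b c /= nb.
by rewrite mem_pmap_sub => bc; apply: rank_succ => //; apply: cguarded.
Qed.

Definition generated : cformula := CFormula gen_guarded.
End Generated.

(* Simultaneous substitution: every vertex labelled Var p is replaced by a
   copy of (sigma p). The vertices are pairs (a; w) with w a vertex of the
   copy of sigma p sitting at a; if a is not labelled by a variable, w ranges
   over a dummy one-vertex graph. *)
Section Substitution.
Variables (sigma : nat -> cformula) (phi : cformula).

Definition fiber (l : label) : cformula := if l is Var p then sigma p else cTop.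

Definition sub_vertex : finType := {a : phi & fiber (lab a)}.

Definition sub_in (a : phi) (w : fiber (lab a)) : sub_vertex :=
  Tagged (fun a => fiber (lab a) : Type) w.

Definition sub_top (a : phi) : sub_vertex := sub_in (root (fiber (lab a))).

Definition sub_lab (u : sub_vertex) : label :=
  if is_var (lab (tag u)) then lab (tagged u) else lab (tag u).

Definition sub_succ (u : sub_vertex) : seq sub_vertex :=
  if is_var (lab (tag u)) then [seq sub_in w | w <- succ (tagged u)]
  else [seq sub_top b | b <- succ (tag u)].

Lemma sub_size u : size (sub_succ u) = arity (sub_lab u).
Proof.
by rewrite /sub_succ /sub_lab; case: ifP => _; rewrite size_map size_succ.
Qed.

Lemma fiber_dummy l (w : fiber l) : ~~ is_var l -> w = root (fiber l).
Proof.
by case: l => [||p|||||] //= in w * => _; case: w => [[[]]|].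
Qed.

Lemma sub_reach u : connect (grel sub_succ) (sub_top (root phi)) u.
Proof.
case: u => a w; apply: (@connect_trans _ _ (sub_top a)).
  have /connectP [p pP ->] := reachable a.
  apply/connectP; exists (map sub_top p); last by rewrite last_map.
  elim: p (root _) pP => //= y p IH x /andP [xy /IH ->]; rewrite andbT.
  rewrite /sub_succ /=; case: ifP => [vx|_]; last exact: map_f.
  have sx : succ x = [::].
    by apply: size0nil; rewrite size_succ; case: (lab x) vx.
  by rewrite /= sx in xy.
have [va|nva] := boolP (is_var (lab a)); last first.
  by rewrite (fiber_dummy w nva); apply: connect0.
have /connectP [p pP ->] := reachable w.
apply/connectP; exists (map (@sub_in a) p); last by rewrite /sub_top last_map.
rewrite /sub_top; elim: p (root _) pP => //= y p IH x /andP [xy /IH ->].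
by rewrite andbT /sub_succ /= va; apply: map_f.
Qed.

Definition sub_graph := Graph sub_size sub_reach.

Lemma sub_guarded : guarded sub_graph.
Proof.
pose M := (\max_(a : phi) #|fiber (lab a)|).+1.
have rM (a : phi) (w : fiber (lab a)) : rank w < M.
  rewrite ltnS; apply: leq_trans (rank_le w) _.
  exact: (@leq_bigmax _ (fun a : phi => #|fiber (lab a)|)).
pose f (u : sub_graph) := rank (tag u) * M + rank (tagged u).
apply: (@rank_guarded _ f) => -[a w] v.
rewrite /= /sub_lab /sub_succ /=; case: ifP => _ na /mapP [b ab ->]; rewrite /f /=.
  by rewrite ltn_add2l; apply: rank_succ => //; apply: cguarded.
have lt : rank b < rank a by apply: rank_succ => //; apply: cguarded.
apply: (@leq_trans ((rank b).+1 * M)).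
  by rewrite mulSn addnC ltn_add2r.
by apply: leq_trans (leq_addr _ _); rewrite leq_mul2r lt orbT.
Qed.

Definition csubst : cformula := CFormula sub_guarded.
End Substitution.

Record language (L : cformula -> Prop) : Prop := Language {
  lang_bisim : forall phi psi : cformula, L phi -> bisimilar phi psi -> L psi;
  lang_var : forall p, L (cVar p);
  lang_conn : forall (l : label) (args : 'I_(arity l) -> cformula),
    (forall i, L (args i)) -> L (cconn args);
  lang_gen : forall (phi : cformula) (a : phi), L phi -> L (generated a);
  lang_subst : forall (sigma : nat -> cformula) (phi : cformula),
    (forall p, L (sigma p)) -> L phi -> L (csubst sigma phi)
}.

Inductive pform : Type :=
  | PVar of nat | PBot | PTop | PNeg of pform
  | PAnd of pform & pform | POr of pform & pform | PImp of pform & pform.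

Fixpoint peval (v : nat -> bool) (A : pform) : bool :=
  match A with
  | PVar p => v p
  | PBot => false
  | PTop => true
  | PNeg A => ~~ peval v A
  | PAnd A B => peval v A && peval v B
  | POr A B => peval v A || peval v B
  | PImp A B => peval v A ==> peval v B
  end.

Definition tautology (A : pform) : Prop := forall v, peval v A.

(* Up to bisimilarity this is csubst sigma applied to A read as a cyclic
   formula; building it from the connectives gives instances the syntactic
   shape that modus ponens expects. *)
Fixpoint pinst (sigma : nat -> cformula) (A : pform) : cformula :=
  match A with
  | PVar p => sigma p
  | PBot => cBot
  | PTop => cTop
  | PNeg A => cNeg (pinst sigma A)
  | PAnd A B => cAnd (pinst sigma A) (pinst sigma B)
  | POr A B => cOr (pinst sigma A) (pinst sigma B)
  | PImp A B => cImp (pinst sigma A) (pinst sigma B)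
  end.

(* A schematic rule is a finite sequence of premises with a conclusion, read
   up to uniform substitution of formulas of L for the variables; a schematic
   axiom is a rule without premises. *)
Definition rule_set : Type := seq cformula -> cformula -> Prop.

(* [derives L rules] is the least extension of HL(L) closed under the given
   schematic rules and under the rules of HL(L). *)
Inductive derives (L : cformula -> Prop) (rules : rule_set) :
    cformula -> Prop :=
  | der_taut (A : pform) (sigma : nat -> cformula) :
      tautology A -> (forall p, L (sigma p)) ->
      derives L rules (pinst sigma A)
  | der_K (A B : cformula) : L A -> L B ->
      derives L rules (cImp (cBox (cImp A B)) (cImp (cBox A) (cBox B)))
  | der_bisim (A B : cformula) : L A -> L B -> bisimilar A B ->
      derives L rules (cIff A B)
  | der_mp (A B : cformula) :
      derives L rules A -> derives L rules (cImp A B) -> derives L rules B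
  | der_nec (A : cformula) : derives L rules A -> derives L rules (cBox A)
  | der_lob (A : cformula) :
      derives L rules (cImp (cBox A) A) -> derives L rules A
  | der_rule (Gamma : seq cformula) (A : cformula) (sigma : nat -> cformula) :
      rules Gamma A -> (forall p, L (sigma p)) ->
      (forall i, i < size Gamma ->
        derives L rules (csubst sigma (nth A Gamma i))) ->
      derives L rules (csubst sigma A).

Definition HL (L : cformula -> Prop) : cformula -> Prop :=
  derives L (fun _ _ => False).

Record logic := Logic {
  lang : cformula -> Prop;
  langP : language lang;
  rules : rule_set;
  rules_lang : forall Gamma A, rules Gamma A ->
    lang A /\ forall i, i < size Gamma -> lang (nth A Gamma i)
}.

Definition provable (Lambda : logic) : cformula -> Prop :=
  derives (lang Lambda) (@rules Lambda).

Lemma HL_provable (Lambda : logic) (A : cformula) :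
  HL (lang Lambda) A -> provable Lambda A.
Proof.
elim=> {A}.
- by move=> A sigma; apply: der_taut.
- by move=> A B; apply: der_K.
- by move=> A B; apply: der_bisim.
- by move=> A B _ hA _ hAB; apply: der_mp hA hAB.
- by move=> A _; apply: der_nec.
- by move=> A _; apply: der_lob.
- by [].
Qed.

Lemma lang_arg (L : cformula -> Prop) (l : label)
    (args : 'I_(arity l) -> cformula) (i : 'I_(arity l)) :
  language L -> L (cconn args) -> L (args i).
Proof.
move=> hL hc; pose r : cconn args := conn_in (root (args i)).
apply: (lang_bisim hL (lang_gen hL r hc)).
exists (fun u b => val u = conn_in b) => // u b ub; split.
  by rewrite /= /gen_lab ub.
move=> j; rewrite /= /gen_lab ub /= => hj.
rewrite -(nth_map _ (val u)) ?size_succ //=; last first.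
  by rewrite (gen_size u) /gen_lab ub.
have -> : [seq val w | w <- gen_succ u] = succ (val u).
  rewrite /gen_succ pmap_filter; last exact: insubK.
  apply/all_filterP/allP => w hw.
  by rewrite insubT //; apply: gen_succ_conn hw.
have -> : succ (val u) = [seq conn_in c | c <- succ b] by rewrite ub.
by rewrite ub (nth_map b) // size_succ.
Qed.

Lemma provable_lang (Lambda : logic) (A : cformula) :
  provable Lambda A -> lang Lambda A.
Proof.
have hL := langP Lambda.
have conn2 B C : lang Lambda B -> lang Lambda C ->
    forall i : 'I_2, lang Lambda (two_args B C i).
  by move=> hB hC i; rewrite /two_args; case: ifP.
have imp B C : lang Lambda B -> lang Lambda C -> lang Lambda (cImp B C).
  by move=> hB hC; apply: (lang_conn hL); apply: conn2.
have box B : lang Lambda B -> lang Lambda (cBox B).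
  by move=> hB; apply: (lang_conn hL).
elim=> {A}.
- move=> A sigma _ hs; elim: A => //=.
  + by apply: (lang_conn hL) => -[].
  + by apply: (lang_conn hL) => -[].
  + by move=> A hA; apply: (lang_conn hL).
  + by move=> A hA B hB; apply: (lang_conn hL); apply: conn2.
  + by move=> A hA B hB; apply: (lang_conn hL); apply: conn2.
  + by move=> A hA B hB; apply: imp.
- by move=> A B hA hB; apply: (imp); [apply/box/imp|apply: (imp); apply: box].
- by move=> A B hA hB _; apply: (lang_conn hL); apply: conn2; apply: imp.
- move=> A B _ _ _ hAB.
  exact: (@lang_arg _ Imp (two_args A B) (@Ordinal 2 1 isT) hL hAB).
- by move=> A _ hA; apply: (lang_conn hL).
- move=> A _ hA.
  exact: (@lang_arg _ Imp (two_args (cBox A) A) (@Ordinal 2 1 isT) hL hA).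
- move=> G A sigma hR hs _ _; apply: (lang_subst hL) => //.
  by have [] := rules_lang hR.
Qed.

Definition local_translation (Lambda : logic) (phi : cformula)
    (T : phi -> cformula) : Prop :=
  (forall a, lang Lambda (T a)) /\
  forall a, provable Lambda
    (cIff (T a) (cconn (fun i : 'I_(arity (lab a)) => T (child a i)))).

(* Main.v *)
Require Import Defs.
From mathcomp Require Import all_boot.
From Stdlib Require Import FunctionalExtensionality.

(* Let chi be the conjunction of T x <-> T' x' over the pairs (x, x') reachable
   from (a, a') in the product of phi and phi'.  Then Lambda proves
   box chi -> (T x <-> T' x') for each of these pairs, by induction on the rank
   of x: at a box vertex, K turns box chi into the equivalence of the two boxes;
   at any other vertex the rank of the children is smaller.  Hence Lambda proves
   box chi -> chi, and Loeb's rule gives chi. *)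

Lemma child_succ (g : graph) (x : g) (i : nat) :
  i < arity (lab x) -> child x i \in succ x.
Proof. by move=> hi; rewrite mem_nth // size_succ. Qed.

(** [R] is an arbitrary proposition-valued relation and cannot be enumerated. The pairs reachable
    from [(a, a')] in the finite product graph can be, and they all lie in [R]. *)
Lemma bisimulation_closed_seq {phi phi' : graph} {R : phi -> phi' -> Prop}
    {a : phi} {a' : phi'} :
  bisimulation R -> R a a' ->
  exists2 s : seq (phi * phi'), (a, a') \in s &
    forall x x', (x, x') \in s -> lab x = lab x' /\
      forall i, i < arity (lab x) -> (child x i, child x' i) \in s.
Proof.
move=> bR aa'.
(* An edge of the product moves both components to their successors of the same index. *)
pose e := [rel p q : phi * phi' |
  [exists i : 'I_(arity (lab p.1)), q == (child p.1 i, child p.2 i)]].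
have cR p : connect e (a, a') p -> R p.1 p.2.
  case/connectP => c; have : R (a, a').1 (a, a').2 by [].
  elim: c (a, a') => [|q c IH] p0 /= hp0; first by move=> _ ->.
  case/andP => /existsP [i /eqP qE]; apply: IH; rewrite qE.
  by have [_] := bR _ _ hp0; apply.
exists (enum (connect e (a, a'))); first by rewrite mem_enum; apply: connect0.
move=> x x'; rewrite mem_enum => cx; have [ll _] := bR _ _ (cR _ cx).
split=> //.
move=> i hi; rewrite mem_enum; apply: connect_trans cx (connect1 _).
by apply/existsP; exists (Ordinal hi).
Qed.

Section Provability.
Set Implicit Arguments.
Unset Strict Implicit.
Variable Lambda : logic.
Notation L := (lang Lambda).
Notation "|- A" := (provable Lambda A) (at level 70).

Lemma lang_cTop : L cTop.
Proof. by apply: (lang_conn (langP Lambda)) => -[]. Qed.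

Lemma lang_cBox A : L A -> L (cBox A).
Proof. by move=> hA; apply: (lang_conn (langP Lambda)). Qed.

Lemma lang_conn2 A B : L A -> L B -> forall i : 'I_2, L (two_args A B i).
Proof. by move=> hA hB i; rewrite /two_args; case: ifP. Qed.

Lemma lang_cAnd A B : L A -> L B -> L (cAnd A B).
Proof.
by move=> hA hB; apply: (lang_conn (langP Lambda)); apply: lang_conn2.
Qed.

Lemma lang_cImp A B : L A -> L B -> L (cImp A B).
Proof.
by move=> hA hB; apply: (lang_conn (langP Lambda)); apply: lang_conn2.
Qed.

Lemma lang_cIff A B : L A -> L B -> L (cIff A B).
Proof. by move=> hA hB; apply: lang_cAnd; apply: lang_cImp. Qed.

(** The list [s] serves as a substitution: variable [i] stands for its [i]-th entry, and the default
    [cTop] keeps all further variables inside the language. *)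
Lemma provable_taut (s : seq cformula) (A : pform) :
  foldr (fun B => and (L B)) True s -> tautology A ->
  |- pinst (nth cTop s) A.
Proof.
move=> hs hA; apply: der_taut hA _.
elim: s hs => [_|B s IH [lB /IH ls]] i; last by case: i.
by rewrite nth_nil; apply: lang_cTop.
Qed.

Lemma provable_mp A B : |- cImp A B -> |- A -> |- B.
Proof. by move=> hAB hA; apply: der_mp hA hAB. Qed.

Definition PIff A B := PAnd (PImp A B) (PImp B A).

(** Truth tables over five variables suffice: no schema below uses more. *)
Ltac by_taut s A :=
  refine (@provable_taut s A _ _);
  [ by do ?split
  | let v := fresh in
    move=> v /=; by case: (v 0) (v 1) (v 2) (v 3) (v 4) => [] [] [] [] [] ].

Lemma provable_imp_trans A B C : L A -> L B -> L C ->
  |- cImp A B -> |- cImp B C -> |- cImp A C.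
Proof.
move=> lA lB lC h1 h2; apply: provable_mp h2; apply: provable_mp h1.
by_taut [:: A; B; C] (PImp (PImp (PVar 0) (PVar 1))
  (PImp (PImp (PVar 1) (PVar 2)) (PImp (PVar 0) (PVar 2)))).
Qed.

Lemma provable_imp_and X A B : L X -> L A -> L B ->
  |- cImp X A -> |- cImp X B -> |- cImp X (cAnd A B).
Proof.
move=> lX lA lB h1 h2; apply: provable_mp h2; apply: provable_mp h1.
by_taut [:: X; A; B] (PImp (PImp (PVar 0) (PVar 1))
  (PImp (PImp (PVar 0) (PVar 2)) (PImp (PVar 0) (PAnd (PVar 1) (PVar 2))))).
Qed.

Lemma provable_and_left A B : L A -> L B -> |- cImp (cAnd A B) A.
Proof.
move=> lA lB; by_taut [:: A; B] (PImp (PAnd (PVar 0) (PVar 1)) (PVar 0)).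
Qed.

Lemma provable_and_right A B : L A -> L B -> |- cImp (cAnd A B) B.
Proof.
move=> lA lB; by_taut [:: A; B] (PImp (PAnd (PVar 0) (PVar 1)) (PVar 1)).
Qed.

Lemma provable_box_mono A B : L A -> L B ->
  |- cImp A B -> |- cImp (cBox A) (cBox B).
Proof. by move=> lA lB /der_nec; apply: provable_mp; apply: der_K. Qed.

Lemma provable_box_iff X A B : L X -> L A -> L B ->
  |- cImp X (cIff A B) -> |- cImp (cBox X) (cIff (cBox A) (cBox B)).
Proof.
move=> lX lA lB h.
have lAB := lang_cImp lA lB; have lBA := lang_cImp lB lA.
have lI := lang_cIff lA lB.
(* Either direction of the equivalence is weakened to an implication under the box, and K then
   distributes the box. *)
have dist C D : L C -> L D -> |- cImp (cIff A B) (cImp C D) ->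
    |- cImp (cBox X) (cImp (cBox C) (cBox D)).
  move=> lC lD hCD; have lCD := lang_cImp lC lD.
  apply: (@provable_imp_trans _ (cBox (cImp C D))); last exact: der_K.
  - exact: lang_cBox.
  - exact: lang_cBox.
  - by apply: lang_cImp; apply: lang_cBox.
  apply: provable_box_mono => //.
  exact: (@provable_imp_trans _ (cIff A B)).
apply: provable_imp_and; [exact: lang_cBox|..].
- by apply: lang_cImp; apply: lang_cBox.
- by apply: lang_cImp; apply: lang_cBox.
- exact/dist/provable_and_left.
- exact/dist/provable_and_right.
Qed.

(** Meant for [A], [A'] translations of two vertices and [B], [B'] their unfoldings into
    connectives: it suffices to compare the unfoldings under [X]. *)
Lemma provable_iff_sandwich X A B A' B' :
  L X -> L A -> L B -> L A' -> L B' ->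
  |- cIff A B -> |- cIff A' B' -> |- cImp X (cIff B B') ->
  |- cImp X (cIff A A').
Proof.
move=> lX lA lB lA' lB' h1 h2 h3.
apply: provable_mp h3; apply: provable_mp h2; apply: provable_mp h1.
by_taut [:: X; A; B; A'; B'] (PImp (PIff (PVar 1) (PVar 2))
  (PImp (PIff (PVar 3) (PVar 4))
    (PImp (PImp (PVar 0) (PIff (PVar 2) (PVar 4)))
      (PImp (PVar 0) (PIff (PVar 1) (PVar 3)))))).
Qed.

(** Arguments indexed by [nat] have a type independent of [l], so the label can be rewritten or
    analysed by cases. *)
Definition conn_nat (l : label) (f : nat -> cformula) : cformula :=
  cconn (fun i : 'I_(arity l) => f i).

Lemma conn_nat0 l f f' : arity l = 0 -> conn_nat l f = conn_nat l f'.
Proof.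
move=> l0; congr cconn; apply: functional_extensionality => -[i hi].
by exfalso; rewrite l0 in hi.
Qed.

(* Extensionality turns the argument families of a local translation into the
   ones used by [pinst], so that tautology instances apply syntactically. *)
Lemma two_argsE (f : nat -> cformula) :
  (fun i : 'I_2 => f i) = two_args (f 0) (f 1).
Proof. by apply: functional_extensionality => -[[|[|]]]. Qed.

Lemma one_argE (f : nat -> cformula) :
  (fun i : 'I_1 => f i) = one_arg (f 0).
Proof. by apply: functional_extensionality => -[[|]]. Qed.

Lemma lang_conn_nat l f : (forall i, L (f i)) -> L (conn_nat l f).
Proof. by move=> lf; apply: (lang_conn (langP Lambda)). Qed.

(** Propositional connectives are congruences under a common hypothesis [X]. For a box, the
    hypothesis itself would have to be boxed, as in [provable_box_iff]. *)
Lemma provable_conn_iff X l f f' :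
  L X -> (forall i, L (f i)) -> (forall i, L (f' i)) -> ~~ is_box l ->
  (forall i, i < arity l -> |- cImp X (cIff (f i) (f' i))) ->
  |- cImp X (cIff (conn_nat l f) (conn_nat l f')).
Proof.
move=> lX lf lf' nb h.
have nullary : arity l = 0 -> |- cImp X (cIff (conn_nat l f) (conn_nat l f')).
  move=> l0; rewrite (conn_nat0 f' f l0).
  have lC := lang_conn_nat l lf.
  by_taut [:: X; conn_nat l f] (PImp (PVar 0) (PIff (PVar 1) (PVar 1))).
(* One argument serves conjunction, disjunction and implication, given that [op] respects
   equivalence under [PVar 0]. *)
have binary (op : pform -> pform -> pform)
    (s := nth cTop [:: X; f 0; f 1; f' 0; f' 1]) :
    tautology (PImp (PImp (PVar 0) (PIff (PVar 1) (PVar 3)))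
      (PImp (PImp (PVar 0) (PIff (PVar 2) (PVar 4)))
        (PImp (PVar 0) (PIff (op (PVar 1) (PVar 2)) (op (PVar 3) (PVar 4)))))) ->
    1 < arity l ->
    |- cImp X (cIff (pinst s (op (PVar 1) (PVar 2)))
                    (pinst s (op (PVar 3) (PVar 4)))).
  move=> op_cong l2; apply: provable_mp (h 1 l2).
  apply: provable_mp (h 0 (ltnW l2)).
  by refine (provable_taut _ op_cong); do ?split.
case: l nb h nullary binary => [||p||//|||] _ h nullary binary.
- exact: nullary.
- exact: nullary.
- exact: nullary.
- rewrite /conn_nat /= !one_argE; apply: provable_mp (h 0 isT).
  by_taut [:: X; f 0; f' 0] (PImp (PImp (PVar 0) (PIff (PVar 1) (PVar 2)))
    (PImp (PVar 0) (PIff (PNeg (PVar 1)) (PNeg (PVar 2))))).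
- rewrite /conn_nat /= !two_argsE; apply: (binary PAnd) => // v /=.
  by case: (v 0) (v 1) (v 2) (v 3) (v 4) => [] [] [] [] [].
- rewrite /conn_nat /= !two_argsE; apply: (binary POr) => // v /=.
  by case: (v 0) (v 1) (v 2) (v 3) (v 4) => [] [] [] [] [].
- rewrite /conn_nat /= !two_argsE; apply: (binary PImp) => // v /=.
  by case: (v 0) (v 1) (v 2) (v 3) (v 4) => [] [] [] [] [].
Qed.

Section Conjunction.
Variables (I : eqType) (F : I -> cformula).
Hypothesis lang_F : forall i, L (F i).

Definition conj_seq (s : seq I) : cformula :=
  foldr (fun i A => cAnd (F i) A) cTop s.

Lemma lang_conj_seq s : L (conj_seq s).
Proof. by elim: s => [|i s IH] /=; [exact: lang_cTop|exact: lang_cAnd]. Qed.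

Lemma provable_conj_seq_elim s i : i \in s -> |- cImp (conj_seq s) (F i).
Proof.
elim: s => //= j s IH; have ls := lang_conj_seq s.
rewrite inE => /orP [/eqP ->|/IH h]; first exact: provable_and_left.
apply: provable_imp_trans h; [exact: lang_cAnd|by []|by []|].
exact: provable_and_right.
Qed.

Lemma provable_conj_seq_intro X s : L X ->
  (forall i, i \in s -> |- cImp X (F i)) -> |- cImp X (conj_seq s).
Proof.
move=> lX; elim: s => [|j s IH] h /=.
  by_taut [:: X] (PImp (PVar 0) PTop).
apply: provable_imp_and => //; first exact: lang_conj_seq.
  by apply: h; rewrite mem_head.
by apply: IH => i hi; apply: h; rewrite inE hi orbT.
Qed.

End Conjunction.

Lemma local_translationE (phi : cformula) (T : phi -> cformula) l x :
  local_translation Lambda T -> lab x = l ->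
  |- cIff (T x) (conn_nat l (fun i => T (child x i))).
Proof. by move=> [_ hT] <-. Qed.

End Provability.

Theorem theorem4p2 (Lambda : logic) (phi phi' : cformula)
    (T : phi -> cformula) (T' : phi' -> cformula)
    (R : phi -> phi' -> Prop) (a : phi) (a' : phi') :
  local_translation Lambda T ->
  local_translation Lambda T' ->
  bisimulation R ->
  R a a' ->
  provable Lambda (cIff (T a) (T' a')).
Proof.
move=> hT hT' bR aa'.
have [lT _] := hT; have [lT' _] := hT'.
have [s sa sP] := bisimulation_closed_seq bR aa'.
pose F (p : phi * phi') := cIff (T p.1) (T' p.2).
have lF p : lang Lambda (F p) by apply: lang_cIff.
pose chi := conj_seq F s.
have lchi : lang Lambda chi by apply: lang_conj_seq.
have lbox : lang Lambda (cBox chi) by apply: lang_cBox.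
suff step p : p \in s -> provable Lambda (cImp (cBox chi) (F p)).
  apply: (@provable_mp _ chi); first exact: (provable_conj_seq_elim lF sa).
  by apply: der_lob; apply: provable_conj_seq_intro.
case: p => x x'; rewrite /F /=.
have [n] := ubnP (rank x); elim: n x x' => // n IH x x' lt_n xx'.
have [ll ch] := sP _ _ xx'.
(* Both vertices are unfolded over the common label [lab x]. *)
apply: (provable_iff_sandwich _ _ _ _ _
  (local_translationE hT (erefl (lab x)))
  (local_translationE hT' (esym ll))) => //; try exact: lang_conn_nat.
have [bx|nb] := boolP (is_box (lab x)); last first.
  apply: provable_conn_iff => // i hi; apply: IH; last exact: ch.
  rewrite -ltnS; apply: leq_trans lt_n; rewrite ltnS.
  by apply: rank_succ => //; [exact: cguarded|exact: child_succ].
have lB : lab x = Box by case: (lab x) bx.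
have y_s : (child x 0, child x' 0) \in s by apply: ch; rewrite lB.
rewrite lB /conn_nat /= !(one_argE (fun i => _ (child _ i))).
(* The induction hypothesis is not called here, since the rank may fail to drop below a box: the
   equivalence for the children is a conjunct of [chi]. *)
apply: provable_box_iff => //.
exact: (provable_conj_seq_elim lF y_s).
Qed.
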